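(* Let $\mathbb{K}$ be a field, $n, s, t \in \mathbb{N}$, let $\le_a$ be an admissible ordering of monomials in $\mathbb{K}[x_1,\ldots,x_n]$, and let $g_1, \ldots, g_s \in \mathbb{K}[x_1,\ldots,x_n] \setminus \{0\}$ be such that for all $i \neq j$, the leading monomials $\mathrm{Lm}(g_i)$ and $\mathrm{Lm}(g_j)$ (with respect to $\le_a$) have no variable in common, i.e. $\gcd(\mathrm{Lm}(g_i), \mathrm{Lm}(g_j)) = 1$. Let $G = \{g_1,\ldots,g_s\}$. Then \[ G^t := \{ g_1^{\alpha_1} \cdots g_s^{\alpha_s} \mid \alpha_1, \ldots, \alpha_s \in \mathbb{N}_0,\ \textstyle\sum_{i=1}^s \alpha_i = t \} \] is a Gröbner basis of the ideal $\langle G\rangle^t$ with respect to $\le_a$.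
   Context: An admissible ordering is a total order $\le_a$ on $\mathbb{N}_0^n$ (identified with monomials $x^\alpha$) with $\alpha \sqsubseteq \beta \Rightarrow \alpha \le_a \beta$ (where $\sqsubseteq$ is componentwise $\le$) and $\alpha \le_a \beta \Rightarrow \alpha+\gamma \le_a \beta+\gamma$. $\mathrm{Lm}(p)$ is the monomial of $p$ with $\le_a$-maximal exponent. $\langle G\rangle$ is the ideal generated by $G$ and $\langle G\rangle^t$ its $t$-th power. A Gröbner basis of an ideal $I$ with respect to $\le_a$ is a finite subset $B \subseteq I$ such that the leading monomial of every nonzero element of $I$ is divisible by $\mathrm{Lm}(b)$ for some $b \in B$. *)

(* Defs.v *)
(* Exponents in N_0^n are elements of 'X_{1..n}; the library order (_ <= _)%MM
   is the componentwise (divisibility) order.  The fixed total order that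
   mpoly puts on 'X_{1..n} (hence mlead) plays no role here. *)
From mathcomp Require Import all_boot all_order all_algebra.
From mathcomp Require Import mpoly.
From mathcomp Require Import classical_sets cardinality.

Set Implicit Arguments.
Unset Strict Implicit.
Unset Printing Implicit Defensive.

Import GRing.Theory.

Local Open Scope classical_set_scope.
Local Open Scope ring_scope.

Section MonomialOrders.
Variable n : nat.

Record admissible_ordering (le_a : rel 'X_{1..n}) : Prop := AdmissibleOrdering {
  adm_refl : reflexive le_a;
  adm_anti : antisymmetric le_a;
  adm_trans : transitive le_a;
  adm_total : total le_a;
  adm_lem : forall a b : 'X_{1..n}, (a <= b)%MM -> le_a a b;
  adm_add : forall a b c : 'X_{1..n}, le_a a b -> le_a (a + c)%MM (b + c)%MM
}.

Definition mgcd (m1 m2 : 'X_{1..n}) : 'X_{1..n} :=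
  [multinom minn (m1 i) (m2 i) | i < n].

(* The monomial x^a is identified with its exponent a.
   Only meaningful for p != 0; Lm le_a 0 = 0%MM is a dummy value. *)
Definition Lm (R : nzRingType) (le_a : rel 'X_{1..n}) (p : {mpoly R[n]})
    : 'X_{1..n} :=
  head 0%MM [seq m <- msupp p | all (fun m' => le_a m' m) (msupp p)].

End MonomialOrders.

Section Ideals.
Variable R : comNzRingType.

Definition ideal_gen (S : set R) : set R :=
  [set p | exists (k : nat) (c f : 'I_k -> R),
     (forall i, S (f i)) /\ p = \sum_(i < k) c i * f i].

(* For t = 0 this is the whole ring. *)
Definition ideal_pow (I : set R) (t : nat) : set R :=
  ideal_gen [set p | exists f : 'I_t -> R,
     (forall i, I (f i)) /\ p = \prod_(i < t) f i].

Definition power_products (s : nat) (g : 'I_s -> R) (t : nat) : set R :=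
  [set p | exists a : 'X_{1..s}, mdeg a = t /\ p = \prod_(i < s) g i ^+ a i].

End Ideals.

(* Divisors are required to be nonzero because Lm is a dummy value at 0. *)
Definition groebner_basis (n : nat) (K : fieldType) (le_a : rel 'X_{1..n})
    (I B : set {mpoly K[n]}) : Prop :=
  [/\ finite_set B, B `<=` I &
      forall p, I p -> p != 0 ->
        exists b, [/\ B b, b != 0 & (Lm le_a b <= Lm le_a p)%MM]].

(* Main.v *)
(* Write L_i = Lm(g_i).  If some L_i is trivial then g_i^t has leading monomial 1.
   Otherwise, call x^r reduced when no L_i divides it.  Solving g_i for its
   leading term rewrites a non-reduced monomial x^m as a combination of
   x^(m - L_i) g_i and smaller monomials; since an admissible ordering is well
   founded (Dickson), every element of <G>^t is a K-linear combination of terms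
   x^r g^a with x^r reduced and |a| >= t.  As the L_i share no variables, the
   leading monomial x^r L^a of such a term determines (r, a), so these leading
   monomials cannot cancel: Lm(p) is one of them, hence divisible by some L^b
   with |b| = t. *)
Require Import Defs.
From mathcomp Require Import all_boot all_order all_algebra.
From mathcomp Require Import mpoly.
From mathcomp Require Import boolp classical_sets cardinality.

Set Implicit Arguments.
Unset Strict Implicit.
Unset Printing Implicit Defensive.

Import GRing.Theory.

Local Open Scope classical_set_scope.
Local Open Scope ring_scope.

(** * Dickson's lemma and maxima of finite lists *)

Lemma monotone_subsequence (u : nat -> nat) :
  exists phi : nat -> nat, {homo phi : k l / (k < l)%N} /\
    {homo u \o phi : k l / (k <= l)%N}.
Proof.
(* Every tail of [u] attains its minimum. [phi] jumps from one tail minimiser to the next, so [u]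
   never decreases along it. *)
have min_after N : exists i, (N <= i)%N /\ forall j, (N <= j)%N -> (u i <= u j)%N.
  have exP : exists v, `[< exists2 i, (N <= i)%N & u i = v >].
    by exists (u N); apply/asboolP; exists N.
  case: (ex_minnP exP) => v /asboolP[i Ni <-] vmin; exists i; split=> // j Nj.
  by apply: vmin; apply/asboolP; exists j.
have [next nextP] := choice min_after.
pose phi := fix phi k := if k is k'.+1 then next (phi k').+1 else next 0%N.
have phi_lt : {homo phi : k l / (k < l)%N}.
  by apply: homo_ltn => [? ? ?|k]; [apply: ltn_trans | case: (nextP (phi k).+1)].
exists phi; split=> //; apply: homo_leq => [//|? ? ?|k]; first exact: leq_trans.
case: k => [|k]; first by case: (nextP 0%N) => _; apply.
case: (nextP (phi k).+1) => _; apply; apply: leq_trans (phi_lt k.+1 k.+2 _) => //.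
by apply: leqW; apply: phi_lt.
Qed.

(** Monotone subsequences are extracted one coordinate after another; any two terms of the last one
    are comparable, so its first two serve. *)
Lemma dickson n (u : nat -> 'X_{1..n}) :
  exists k l, (k < l)%N /\ (u k <= u l)%MM.
Proof.
suff [phi [phi_lt phi_le]] : exists phi : nat -> nat,
    {homo phi : k l / (k < l)%N} /\
    forall i, i \in enum 'I_n -> {homo (fun k => u (phi k) i) : k l / (k <= l)%N}.
  exists (phi 0%N), (phi 1%N); split; first exact: phi_lt.
  by apply/mnm_lepP => i; apply: phi_le => //; rewrite mem_enum.
elim: (enum _) => [|i s [phi [phi_lt phi_le]]]; first by exists id; split.
have [psi [psi_lt psi_le]] := monotone_subsequence (fun k => u (phi k) i).
exists (phi \o psi); split=> [k l kl|j]; first by apply/phi_lt/psi_lt.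
rewrite inE => /predU1P[-> //|js] k l kl /=; apply: phi_le => //.
by move: kl; rewrite leq_eqVlt => /predU1P[-> //|/psi_lt/ltnW].
Qed.

Lemma total_max (T : eqType) (r : rel T) (x0 : T) (s : seq T) :
  transitive r -> total r ->
  exists2 x, x \in x0 :: s & {in x0 :: s, forall y, r y x}.
Proof.
move=> r_tr r_tot; have rxx y : r y y by case/orP: (r_tot y y).
elim: s x0 => [|y s IHs] x0.
  by exists x0 => [|z]; rewrite inE // => /eqP->.
have [x xs xmax] := IHs y; case/orP: (r_tot x0 x) => x0x.
  exists x => [|z]; first by rewrite inE xs orbT.
  by rewrite inE => /predU1P[-> //|/xmax].
exists x0 => [|z]; first by rewrite mem_head.
by rewrite inE => /predU1P[-> //|/xmax/r_tr]; apply.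
Qed.

(** * Linear combinations of a family *)

Section LinearCombinations.
Variables (K : fieldType) (V : lmodType K) (I : eqType) (S : pred I) (f : I -> V).

(** With distinct indices each index carries a single coefficient, as the non-cancellation of
    leading monomials requires. *)
Definition lincomb (p : V) : Prop :=
  exists (L : seq I) (c : I -> K),
    [/\ uniq L, all S L & p = \sum_(x <- L) c x *: f x].

Lemma lincomb0 : lincomb 0.
Proof. by exists [::], (fun=> 0); rewrite big_nil. Qed.

Lemma lincomb_base x : S x -> lincomb (f x).
Proof.
by move=> Sx; exists [:: x], (fun=> 1); rewrite /= Sx big_seq1 scale1r.
Qed.

Lemma lincombZ a p : lincomb p -> lincomb (a *: p).
Proof.
move=> [L [c [uL SL ->]]]; exists L, (fun x => a * c x); split=> //.
by rewrite scaler_sumr; apply: eq_bigr => x _; rewrite scalerA.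
Qed.

Lemma lincombD p q : lincomb p -> lincomb q -> lincomb (p + q).
Proof.
move=> [L1 [c1 [uL1 SL1 ->]]] [L2 [c2 [uL2 SL2 ->]]].
pose L := undup (L1 ++ L2).
(* Both sums are padded with zero coefficients to the common index list [L]. *)
have widen (M : seq I) (c : I -> K) : uniq M -> {subset M <= L} ->
    \sum_(x <- M) c x *: f x = \sum_(x <- L) (if x \in M then c x else 0) *: f x.
  move=> uM ML.
  rewrite [RHS](eq_bigr (fun x => if x \in M then c x *: f x else 0)); last first.
    by move=> x _; case: ifP; rewrite ?scale0r.
  rewrite -big_mkcond -big_filter; apply/perm_big/uniq_perm => //.
    by rewrite filter_uniq ?undup_uniq.
  by move=> x; rewrite mem_filter; case: (boolP (x \in M)) => // /ML ->.
exists L, (fun x => (if x \in L1 then c1 x else 0) + (if x \in L2 then c2 x else 0)).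
split; first exact: undup_uniq.
  apply/allP => x; rewrite mem_undup mem_cat => /orP[]; first exact: (allP SL1).
  exact: (allP SL2).
rewrite (widen L1) ?(widen L2) //; first by
  rewrite -big_split; apply: eq_bigr => x _; rewrite scalerDl.
- by move=> x xL; rewrite mem_undup mem_cat xL orbT.
- by move=> x xL; rewrite mem_undup mem_cat xL.
Qed.

Lemma lincomb_sum (J : eqType) (r : seq J) (F : J -> V) :
  {in r, forall j, lincomb (F j)} -> lincomb (\sum_(j <- r) F j).
Proof.
by move=> HF; rewrite big_seq; apply: big_ind => //;
  [exact: lincomb0 | exact: lincombD].
Qed.

End LinearCombinations.

(** * Well-foundedness of admissible orderings and leading monomials *)

Section LeadingMonomials.
Variables (K : fieldType) (n : nat) (le_a : rel 'X_{1..n}).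
Hypothesis le_aP : admissible_ordering le_a.

Let lt_a (m1 m2 : 'X_{1..n}) := (m1 != m2) && le_a m1 m2.

Lemma lt_a_trans : transitive lt_a.
Proof.
move=> y x z /andP[xy lexy] /andP[yz leyz]; rewrite /lt_a (adm_trans le_aP lexy leyz).
rewrite andbT; apply/eqP => xz; subst z.
by case/eqP: xy; apply: (adm_anti le_aP); rewrite lexy.
Qed.

(** A counterexample would start an infinite strictly descending sequence, in which Dickson's lemma
    finds an earlier term dividing a later one, against antisymmetry. *)
Lemma admissible_ind (P : 'X_{1..n} -> Prop) :
  (forall m, (forall m', m' != m -> le_a m' m -> P m') -> P m) -> forall m, P m.
Proof.
move=> IH m0; apply: contrapT => nPm0.
have descent m : exists m', ~ P m -> ~ P m' /\ lt_a m' m.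
  case: (pselect (P m)) => [Pm|nPm]; first by exists m.
  apply: contrapT => nex; apply: (nPm); apply: IH => m' m'm lem'm.
  by apply: contrapT => nPm'; apply: nex; exists m'; rewrite /lt_a m'm.
have [next nextP] := choice descent.
pose u k := iter k next m0.
have nPu k : ~ P (u k) by elim: k => //= k /nextP[].
have u_dec : {homo u : k l / (k < l)%N >-> lt_a l k}.
  apply: homo_ltn => [y x z yx zy|k]; first exact: lt_a_trans zy yx.
  by case: (nextP _ (nPu k)).
have [k [l [/u_dec/andP[ulk leulk] /(adm_lem le_aP) leukl]]] := dickson u.
by case/eqP: ulk; apply: (adm_anti le_aP); rewrite leulk.
Qed.

Lemma le_a_add m1 m2 k1 k2 :
  le_a m1 m2 -> le_a k1 k2 -> le_a (m1 + k1)%MM (m2 + k2)%MM.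
Proof.
move=> le1 le2; apply: (adm_trans le_aP (adm_add le_aP k1 le1)).
by rewrite ![(m2 + _)%MM]addmC; apply: adm_add.
Qed.

(** [m2 + k1] is squeezed between the equal monomials [m1 + k1] and [m2 + k2]. Hence the leading
    term of a product arises from one pair of terms only. *)
Lemma le_a_add_eq m1 m2 k1 k2 : le_a m1 m2 -> le_a k1 k2 ->
  (m1 + k1 = m2 + k2)%MM -> m1 = m2 /\ k1 = k2.
Proof.
move=> le1 le2 eqD; suff k12 : k1 = k2 by move: eqD; rewrite k12 => /addIm.
apply: (@addmI _ m2); apply: (adm_anti le_aP).
rewrite -{2}eqD (adm_add le_aP _ le1) andbT.
by rewrite ![(m2 + _)%MM]addmC (adm_add le_aP).
Qed.

(** A relational form of [Lm] that avoids its dummy value: it can only hold for nonzero [p]. *)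
Definition is_lead (p : {mpoly K[n]}) (m : 'X_{1..n}) : Prop :=
  m \in msupp p /\ {in msupp p, forall m', le_a m' m}.

Lemma is_lead_Lm p m : is_lead p m -> Lm le_a p = m.
Proof.
move=> [mp mmax]; rewrite /Lm.
set s := filter _ _.
have : m \in s by rewrite mem_filter mp andbT; apply/allP.
have : {in s, forall m', m' = m}.
  move=> m'; rewrite mem_filter => /andP[/allP m'max m'p].
  by apply: (adm_anti le_aP); rewrite mmax ?m'max.
by case: s => //= m' s' eqm _; apply: eqm; rewrite mem_head.
Qed.

Lemma Lm_is_lead p : p != 0 -> is_lead p (Lm le_a p).
Proof.
rewrite -msupp_eq0 => p0; suff [m ml] : exists m, is_lead p m.
  by rewrite (is_lead_Lm ml).
rewrite /is_lead; case: (msupp p : seq _) p0 => // m s _.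
have [m' m's m'max] := total_max m s (adm_trans le_aP) (adm_total le_aP).
by exists m'.
Qed.

Lemma is_lead_neq0 p m : is_lead p m -> p != 0.
Proof. by case=> mp _; rewrite -msupp_eq0; apply: contraTneq mp => ->. Qed.

Lemma is_lead_mpolyX m : is_lead 'X_[m] m.
Proof.
by split=> [|m']; rewrite msuppX inE // => /eqP ->; apply: adm_refl.
Qed.

Lemma is_leadM p q m k : is_lead p m -> is_lead q k -> is_lead (p * q) (m + k)%MM.
Proof.
move=> [mp mmax] [kq kmax]; split=> [|m' /msuppM_le/allpairsP[[m1 k1] /= [m1p k1q ->]]];
  last by apply: le_a_add; [apply: mmax | apply: kmax].
(* [mcoeffM] sums over pairs of monomials of bounded degree; these bounds place [(m, k)] among
   them. *)
have bnd (h l : 'X_{1..n}) : (mdeg h < (mdeg (h + l)).+1)%N.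
  by rewrite mdegD ltnS leq_addr.
have bnd' (h l : 'X_{1..n}) : (mdeg l < (mdeg (h + l)).+1)%N.
  by rewrite addmC; apply: bnd.
rewrite mcoeff_msupp mcoeffM.
rewrite (bigD1 (BMultinom (bnd m k), BMultinom (bnd' m k))) //= big1 ?addr0.
  by rewrite mulf_neq0 -?mcoeff_msupp.
case=> -[m1 ?] [k1 ?] /= /andP[/eqP eqmk neq].
have [m1p|/memN_msupp_eq0 ->] := boolP (m1 \in msupp p); last by rewrite mul0r.
have [k1q|/memN_msupp_eq0 ->] := boolP (k1 \in msupp q); last by rewrite mulr0.
have [m1m k1k] := le_a_add_eq (mmax _ m1p) (kmax _ k1q) (esym eqmk).
by case/eqP: neq; congr pair; apply: val_inj.
Qed.

Lemma is_leadXn p m k : is_lead p m -> is_lead (p ^+ k) (m *+ k)%MM.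
Proof.
move=> pm; elim: k => [|k IHk]; last by rewrite exprS mulmS; apply: is_leadM.
by rewrite expr0 mulm0n -mpolyX0; apply: is_lead_mpolyX.
Qed.

Lemma is_lead_prod (I : Type) (r : seq I) (F : I -> {mpoly K[n]}) (l : I -> 'X_{1..n}) :
  (forall i, is_lead (F i) (l i)) ->
  is_lead (\prod_(i <- r) F i) (\sum_(i <- r) l i)%MM.
Proof.
move=> Fl; elim: r => [|i r IHr]; last by rewrite !big_cons; apply: is_leadM.
by rewrite !big_nil -mpolyX0; apply: is_lead_mpolyX.
Qed.

(* Distinct leading monomials cannot cancel: the largest one survives. *)
Lemma lincomb_lead (I : eqType) (S : pred I) (f : I -> {mpoly K[n]})
    (l : I -> 'X_{1..n}) (p : {mpoly K[n]}) :
  (forall x, S x -> is_lead (f x) (l x)) -> {in S &, injective l} ->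
  lincomb S f p -> p != 0 -> exists2 x, S x & is_lead p (l x).
Proof.
move=> fl l_inj [L [c [uL SL pE]]] p0.
(* Without zero coefficients, the maximal term is sure to contribute. *)
pose L' := [seq x <- L | c x != 0].
have {}pE : p = \sum_(x <- L') c x *: f x.
  rewrite big_filter big_mkcond pE; apply: eq_bigr => x _.
  by case: eqP => // ->; rewrite scale0r.
have S_L' x : x \in L' -> S x by rewrite mem_filter => /andP[_ /(allP SL)].
have c_L' x : x \in L' -> c x != 0 by rewrite mem_filter => /andP[].
have uL' : uniq L' by rewrite filter_uniq.
have [x [xL' xmax]] : exists x, x \in L' /\ {in L', forall y, le_a (l y) (l x)}.
  case: (L') pE => [|x0 L0] pE; first by rewrite pE big_nil eqxx in p0.
  have [x] := @total_max _ (relpre l le_a) x0 L0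
    (fun y x z => @adm_trans _ _ le_aP _ _ _) (fun x y => adm_total le_aP _ _).
  by exists x.
exists x; first exact: S_L'; split.
  rewrite mcoeff_msupp pE raddf_sum /= (bigD1_seq x) //= big_seq_cond big1.
    by rewrite addr0 mcoeffZ mulf_neq0 ?c_L' // -mcoeff_msupp; case: (fl x (S_L' x xL')).
  (* If [l x] occurred in [f y], then [l x] and [l y] would bound each other, and injectivity would
     give [y = x]. *)
  move=> y /andP[yL' yx]; rewrite mcoeffZ; apply/eqP; rewrite mulf_eq0 mcoeff_eq0.
  apply/orP; right; apply: contraNN yx => xy; apply/eqP/l_inj; try exact: S_L'.
  have [_ ymax] := fl y (S_L' y yL').
  by apply: (adm_anti le_aP); rewrite xmax // ymax.
move=> m; rewrite pE => /msupp_sum_le/flatten_mapP[y].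
rewrite filter_predT => yL' /msuppZ_le my; have [_ ymax] := fl y (S_L' y yL').
exact: (adm_trans le_aP) (ymax _ my) (xmax _ yL').
Qed.

End LeadingMonomials.

(** * Power products and the easy inclusions *)

Section PowerProducts.
Variables (R : comNzRingType) (s : nat) (g : 'I_s -> R).

Definition power_product (a : 'X_{1..s}) : R := \prod_(i < s) g i ^+ a i.

Lemma power_product0 : power_product 0 = 1.
Proof. by rewrite /power_product big1 // => i _; rewrite mnm0E. Qed.

Lemma power_productS a i : power_product (a + U_(i)) = power_product a * g i.
Proof.
rewrite /power_product [LHS](bigD1 i) //= [in RHS](bigD1 i) //= mnmDE mnm1E eqxx.
rewrite addn1 exprSr -!mulrA; congr (_ * _); rewrite [RHS]mulrC; congr (_ * _).
by apply: eq_bigr => j ji; rewrite mnmDE mnm1E eq_sym (negPf ji) addn0.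
Qed.

End PowerProducts.

Lemma mnm_degS s (a : 'X_{1..s}) t : mdeg a = t.+1 ->
  exists i b, a = (b + U_(i))%MM /\ mdeg b = t.
Proof.
move=> degS; have [i ai] : exists i, a i != 0%N.
  apply/existsP; apply: contra_eqT degS => /existsPn a0.
  by rewrite mdegE big1 // => i _; apply/eqP; rewrite -[_ == _]negbK a0.
have eqa : a = (a - U_(i) + U_(i))%MM by rewrite submK // lep1mP.
exists i, (a - U_(i))%MM; split=> //.
by apply: succn_inj; rewrite -degS {2}eqa mdegD mdeg1 addn1.
Qed.

(** Serves to pass from a product of at least [t] leading monomials to a divisor with exactly [t]
    factors. *)
Lemma mnm_sub_deg s (a : 'X_{1..s}) t : (t <= mdeg a)%N ->
  exists2 b : 'X_{1..s}, (b <= a)%MM & mdeg b = t.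
Proof.
move=> /subnKC; move: (mdeg a - t)%N => k.
elim: k a => [|k IHk] a deg_a; first by exists a; rewrite ?lepm_refl -?deg_a ?addn0.
have [|i [b [ab /esym deg_b]]] := @mnm_degS s a (t + k); first by rewrite -deg_a addnS.
have [b' b'b <-] := IHk b deg_b; exists b' => //.
by rewrite ab; apply: lepm_trans b'b (lem_addr _ _).
Qed.

(** Powers of ideals are generated by products indexed by ['I_t], so exponents are unfolded into a
    list of factors. *)
Lemma power_product_seq (R : comNzRingType) s (g : 'I_s -> R) (a : 'X_{1..s}) :
  exists2 r : seq 'I_s, size r = mdeg a & power_product g a = \prod_(i <- r) g i.
Proof.
move: {2}(mdeg a) (erefl (mdeg a)) => t; elim: t a => [|t IHt] a deg_a.
  exists [::]; first by rewrite deg_a.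
  move/eqP: deg_a; rewrite mdeg_eq0 => /eqP ->.
  by rewrite power_product0 big_nil.
have [i [b [-> /IHt[r sz_r rE]]]] := mnm_degS deg_a.
exists (i :: r); first by rewrite /= sz_r mdegD mdeg1 addn1.
by rewrite power_productS big_cons mulrC rE.
Qed.

Lemma ideal_gen_sub (R : comNzRingType) (S : set R) : S `<=` ideal_gen S.
Proof.
move=> p Sp; exists 1%N, (fun=> 1), (fun=> p); split=> //.
by rewrite big_ord1 mul1r.
Qed.

Lemma power_products_sub (R : comNzRingType) s (g : 'I_s -> R) t :
  power_products g t `<=` ideal_pow (ideal_gen (range g)) t.
Proof.
move=> _ [a [<- ->]]; apply: ideal_gen_sub.
have [r <- rE] := power_product_seq g a.
exists (fun k => g (tnth (in_tuple r) k)); split.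
  by move=> k; apply: ideal_gen_sub; exists (tnth (in_tuple r) k).
by rewrite -/(power_product g a) rE big_tnth.
Qed.

Lemma finite_power_products (R : comNzRingType) s (g : 'I_s -> R) t :
  finite_set (power_products g t).
Proof.
apply: sub_finite_set
  (finite_image (fun a : 'X_{1..s < t.+1} => power_product g a) (@finite_finset _ setT)).
move=> _ [a [deg_a ->]]; have a_lt : (mdeg a < t.+1)%N by rewrite deg_a.
by exists (BMultinom a_lt).
Qed.

(** * Standard terms and the Gröbner property *)

Section GroebnerBasis.
Variables (K : fieldType) (n s t : nat) (le_a : rel 'X_{1..n}).
Hypothesis le_aP : admissible_ordering le_a.
Variable g : 'I_s -> {mpoly K[n]}.
Hypothesis g_neq0 : forall i, g i != 0.
Hypothesis g_coprime : forall i j, i != j ->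
  mgcd (Lm le_a (g i)) (Lm le_a (g j)) = 0%MM.

Let L i := Lm le_a (g i).
Let Lprod (a : 'X_{1..s}) : 'X_{1..n} := (\sum_(i < s) L i *+ a i)%MM.

Lemma is_lead_power_product a : is_lead le_a (power_product g a) (Lprod a).
Proof.
by apply: is_lead_prod => // i; apply: is_leadXn => //; apply: Lm_is_lead.
Qed.

Definition reduced (r : 'X_{1..n}) := [forall i, ~~ (L i <= r)%MM].

(** The degree is only bounded below, because trading a factor [L i] of the monomial for [g i]
    raises it. *)
Definition standard (x : 'X_{1..n} * 'X_{1..s}) :=
  reduced x.1 && (t <= mdeg x.2)%N.

Definition standard_term (x : 'X_{1..n} * 'X_{1..s}) : {mpoly K[n]} :=
  'X_[x.1] * power_product g x.2.

Let standard_Lm (x : 'X_{1..n} * 'X_{1..s}) : 'X_{1..n} := (x.1 + Lprod x.2)%MM.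

Lemma is_lead_standard_term x : is_lead le_a (standard_term x) (standard_Lm x).
Proof.
by apply: is_leadM => //; [apply: is_lead_mpolyX | apply: is_lead_power_product].
Qed.

(** By coprimality, a variable occurring in [L i] occurs in no other [L k]. *)
Lemma Lprod_coord a i j : L i j != 0%N -> Lprod a j = (L i j * a i)%N.
Proof.
move=> Lij; rewrite mnm_sumE (bigD1 i) //= mulmnE big1 ?addn0 // => k ki.
rewrite mulmnE; have := g_coprime ki => /mnmP/(_ j); rewrite mnmE mnm0E -/(L k) -/(L i).
by move/eqP; rewrite -leqn0 geq_min !leqn0 (negPf Lij) orbF => /eqP ->.
Qed.

(* At a coordinate [j] where [r j < L i j], the exponent [a i] is the quotient
   of [(r + Lprod a) j] by [L i j]. *)
Lemma reduced_exponent_le r a r' a' i : reduced r ->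
  (r + Lprod a = r' + Lprod a')%MM -> (a' i <= a i)%N.
Proof.
move=> /forallP/(_ i) /mnm_lepP nle eqra.
have [j] : exists j, ~~ (L i j <= r j)%N.
  by apply/existsP; rewrite -negb_forall; apply/negP => /forallP.
rewrite -ltnNge => rj; have Lij : L i j != 0%N by rewrite -lt0n (leq_ltn_trans _ rj).
have /mnmP/(_ j) := eqra; rewrite !mnmDE !(Lprod_coord _ Lij) => eqj.
(* With [q = L i j]: [q * a' i <= r' j + q * a' i = r j + q * a i < q * (a i).+1]. *)
rewrite -ltnS -(ltn_pmul2l (m := L i j)) ?lt0n // mulnS.
apply: leq_ltn_trans (leq_addl (r' j) _) _.
by rewrite -eqj ltn_add2r.
Qed.

Lemma standard_Lm_inj : {in standard &, injective standard_Lm}.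
Proof.
move=> [r a] [r' a'] /andP[/= red_r _] /andP[/= red_r' _] /= eqra.
have eqa : a = a'.
  apply/mnmP => i; apply/eqP; rewrite eqn_leq (reduced_exponent_le _ red_r eqra) andbT.
  exact: reduced_exponent_le red_r' (esym eqra).
by move: eqra; rewrite /standard_Lm /= eqa => /addIm ->.
Qed.

Let spanned := lincomb standard standard_term.

Lemma spanned_monomial : (forall i, L i != 0%MM) ->
  forall m b, (t <= mdeg b)%N -> spanned ('X_[m] * power_product g b).
Proof.
(* The exponent [b] stays general in the induction, since a rewriting step may increase it. *)
move=> L_neq0; apply: (admissible_ind le_aP) => m IHm b tb.
have [red_m|] := boolP (reduced m).
  by apply: (@lincomb_base _ _ _ standard standard_term (m, b)); rewrite /standard red_m.
rewrite negb_forall => /existsP[i]; rewrite negbK => Lim.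
have [Lig Limax] := Lm_is_lead le_aP (g_neq0 i); rewrite -/(L i) in Lig Limax.
pose m' := (m - L i)%MM; have mE : m = (m' + L i)%MM by rewrite submK.
pose c := (g i)@_(L i); have c0 : c != 0 by rewrite -mcoeff_msupp.
have gE : 'X_[m'] * g i = c *: 'X_[m] +
    \sum_(u <- rem (L i) (msupp (g i))) (g i)@_u *: 'X_[m' + u].
  rewrite {1}[g i]mpolyE (big_rem _ Lig) /= mulrDr -scalerAr -mpolyXD -mE.
  congr (_ + _); rewrite mulr_sumr; apply: eq_bigr => u _.
  by rewrite -scalerAr -mpolyXD.
have -> : 'X_[m] * power_product g b =
    c^-1 *: ('X_[m'] * power_product g (b + U_(i)) +
    \sum_(u <- rem (L i) (msupp (g i)))
      (- (g i)@_u) *: ('X_[m' + u] * power_product g b)).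
  rewrite power_productS mulrA mulrAC gE mulrDl -addrA mulr_suml -big_split big1 /=.
    by rewrite addr0 -scalerAl scalerA mulVf ?scale1r.
  by move=> u _; rewrite -scalerAl -scalerDl subrr scale0r.
apply/lincombZ/lincombD.
  (* Here [m'] is strictly below [m] because [L i] is nontrivial. *)
  apply: IHm; last by rewrite mdegD (leq_trans tb) ?leq_addr.
    by rewrite -[m']addm0 mE eqm_add2l eq_sym.
  by apply: (adm_lem le_aP); rewrite mE lem_addr.
(* The tail monomials [u] of [g i] lie strictly below [L i], so [m' + u] lies strictly below [m]. *)
apply: lincomb_sum => u; rewrite (rem_filter _ (msupp_uniq _)) mem_filter => /andP[uL ug].
apply/lincombZ/IHm => //; first by rewrite mE eqm_add2l.
by rewrite mE; apply: le_a_add => //; [apply: adm_refl | apply: Limax].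
Qed.

Lemma spanned_ideal_pow : (forall i, L i != 0%MM) ->
  ideal_pow (ideal_gen (range g)) t `<=` spanned.
Proof.
move=> L_neq0 _ [k [c [f [fI ->]]]]; apply: lincomb_sum => j _.
have [fj [fjI ->]] := fI j.
(* The factors are expanded one at a time: [h] collects coefficients and [b] the generators chosen,
   so absorbed and remaining factors together number at least [t]. *)
suff prod_spanned (r : seq 'I_t) h b : (t <= mdeg b + size r)%N ->
    spanned (h * power_product g b * \prod_(i <- r) fj i).
  have := prod_spanned (index_enum _) (c j) 0%MM.
  rewrite power_product0 mulr1; apply.
  by rewrite [index_enum _]unlock -enumT size_enum_ord leq_addl.
elim: r h b => [|i r IHr] h b /= tb.
  rewrite big_nil mulr1 [h]mpolyE mulr_suml; apply: lincomb_sum => m _.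
  by rewrite -scalerAl; apply/lincombZ/spanned_monomial; rewrite // -[mdeg b]addn0.
rewrite big_cons; have [l [d [e [eg ->]]]] := fjI i.
rewrite mulrA mulr_sumr mulr_suml; apply: lincomb_sum => v _.
have [w _ <-] := eg v.
have -> : h * power_product g b * (d v * g w) = h * d v * power_product g (b + U_(w)).
  by rewrite power_productS mulrACA.
by apply: IHr; rewrite mdegD mdeg1 addn1 addSnnS.
Qed.

Lemma groebner_basis_power_products :
  groebner_basis le_a (ideal_pow (ideal_gen (range g)) t) (power_products g t).
Proof.
split; [exact: finite_power_products | exact: power_products_sub|].
move=> p Ip p0.
have [b deg_b Lb] : exists2 b : 'X_{1..s}, mdeg b = t & (Lprod b <= Lm le_a p)%MM.
  have [/forallP L_neq0|] := boolP [forall i, L i != 0%MM].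
    have [x /andP[_ tx]] := lincomb_lead le_aP (fun x _ => is_lead_standard_term x)
      standard_Lm_inj (spanned_ideal_pow L_neq0 Ip) p0.
    move=> /(is_lead_Lm le_aP) ->; have [b bx deg_b] := mnm_sub_deg tx; exists b => //.
    apply: lepm_trans (lem_addl _ _); apply/mnm_lepP => j.
    by rewrite !mnm_sumE leq_sum // => i _; rewrite !mulmnE leq_mul2l (mnm_lepP bx) orbT.
  rewrite negb_forall => /existsP[i]; rewrite negbK => /eqP Li0.
  (* This is the exponent of [g i ^+ t], whose leading monomial is trivial and divides
     everything. *)
  exists (U_(i) *+ t)%MM; first by rewrite mdegMn mdeg1 mul1n.
  apply/mnm_lepP => j; rewrite mnm_sumE big1 // => k _.
  rewrite mulmnE [(_ *+ t)%MM k]mulmnE mnm1E.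
  by have [<-|_] := eqVneq i k; rewrite ?Li0 ?mnm0E ?mul0n ?muln0.
have lead_b := is_lead_power_product b.
exists (power_product g b); split; first by exists b.
  exact: is_lead_neq0 lead_b.
by rewrite (is_lead_Lm le_aP lead_b).
Qed.

End GroebnerBasis.

Theorem theorem6p4 (K : fieldType) (n s t : nat)
    (n_gt0 : (0 < n)%N) (s_gt0 : (0 < s)%N) (t_gt0 : (0 < t)%N)
    (le_a : rel 'X_{1..n}) (le_aP : admissible_ordering le_a)
    (g : 'I_s -> {mpoly K[n]})
    (g_neq0 : forall i, g i != 0)
    (g_coprime : forall i j, i != j ->
       mgcd (Lm le_a (g i)) (Lm le_a (g j)) = 0%MM) :
  groebner_basis le_a (ideal_pow (ideal_gen (range g)) t) (power_products g t).
Proof. exact: groebner_basis_power_products. Qed.
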